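(* Let $\delta\in\mathbb{R}$, $0<\beta<mn$ and $\tilde\delta<\tau=(\beta-mn)(1-1/m)+\delta/m$. Let $\vec{p}=(p_1,\dots,p_m)$ be a vector of exponents and $\vec v=(v_1,\dots,v_m)$ a vector of weights. Then $\vec{v}\in\mathbb{H}_m(\vec{p},\beta,\tilde\delta)$ if and only if $\vec{v}\in A_{\vec{p},\infty}$.
   Context: $m,n\in\mathbb{N}$; the underlying space is $\mathbb{R}^n$. A weight is any positive and locally integrable function. $\mathcal{X}_B$ is the characteristic function of $B$. A vector of exponents is $\vec{p}=(p_1,\dots,p_m)$ with $1\le p_i\le\infty$ for every $i$; $p_i'$ is the conjugate exponent of $p_i$. The number $\tilde\delta$ is real. For a weight $w$ and a vector of weights $\vec v$, $(w,\vec{v})\in\mathbb{H}_m(\vec{p},\beta,\tilde\delta)$ (with $\delta$ fixed, and here with $\beta_i=\beta/m$ for every $i$) means that there is $C>0$ such that for every ball $B=B(x_B,R)$ $$\frac{\|w\mathcal{X}_B\|_\infty}{|B|^{(\tilde\delta-\delta)/n}}\prod_{i=1}^m\left(\int_{\mathbb{R}^n}\frac{v_i^{-p_i'}(y)}{(|B|^{1/n}+|x_B-y|)^{(n-\beta_i+\delta/m)p_i'}}\,dy\right)^{1/p_i'}\le C,$$ where for $p_i=1$ the $i$-th factor is understood as $\left\|\frac{v_i^{-1}}{(|B|^{1/n}+|x_B-\cdot|)^{n-\beta_i+\delta/m}}\right\|_\infty$. One writes $\vec{v}\in\mathbb{H}_m(\vec{p},\beta,\tilde\delta)$ when this holds with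 $w=\prod_{i=1}^m v_i$. $\vec{v}\in A_{\vec{p},\infty}$ means $$\sup_{B}\left\|\mathcal{X}_B\prod_{i=1}^m v_i\right\|_\infty\prod_{i=1}^m\left(\frac{1}{|B|}\int_B v_i^{-p_i'}\right)^{1/p_i'}<\infty,$$ the supremum being over all balls $B\subset\mathbb{R}^n$, with the $i$-th factor understood as $\|v_i^{-1}\mathcal{X}_B\|_\infty$ when $p_i=1$.
   Formalization: The direction from A to H is stated under the added relation δ̃ = β − n/p, with 1/p = Σ 1/p_i; without it the claim fails (m=n=1, v=1, p=1, β=1/2, δ=10, δ̃=0). The direction H to A is unrestricted. Weights are Borel measurable. *)

(* Defs.v *)
From HB Require Import structures.
From mathcomp Require Import all_boot all_order all_algebra.
From mathcomp Require Import all_classical all_reals all_analysis.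
Set Implicit Arguments.
Unset Strict Implicit.
Unset Printing Implicit Defensive.
Import Order.TTheory GRing.Theory Num.Def Num.Theory.
Import numFieldNormedType.Exports.
Local Open Scope classical_set_scope.
Local Open Scope ring_scope.

(* The points of R^n are n-tuples; the library gives this type the product
   sigma-algebra, that is, the Borel sigma-algebra of R^n. *)
Notation Rn R n := (n.-tuple (measurableTypeR R)).

Section lebesgue_measure_on_Rn.
Context {R : realType}.

Definition Rn_cons n (xt : measurableTypeR R * Rn R n) : Rn R n.+1 :=
  [tuple of xt.1 :: xt.2].

Lemma measurable_Rn_cons n :
  measurable_fun [set: measurableTypeR R * Rn R n] (@Rn_cons n).
Proof. exact: (measurable_cons measurable_fst measurable_snd). Qed.

Definition lebesgue_Rn_succ n (mu : {measure set (Rn R n) -> \bar R}) :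
    set (Rn R n.+1) -> \bar R :=
  pushforward (lebesgue_measure \x^ mu)%E (@Rn_cons n).

HB.instance Definition _ n (mu : {measure set (Rn R n) -> \bar R}) :=
  Measure.copy (lebesgue_Rn_succ mu)
    (measure_function_pushforward__canonical__measure_function_Measure
      (lebesgue_measure \x^ mu)%E (@measurable_Rn_cons n)).

(* Lebesgue measure on R^n: unit mass on R^0, and the product of the
   one-dimensional Lebesgue measure with that of R^n on R^(n+1). *)
Fixpoint lebesgue_Rn n : {measure set (Rn R n) -> \bar R} :=
  match n return {measure set (Rn R n) -> \bar R} with
  | 0 => dirac [tuple]
  | k.+1 => lebesgue_Rn_succ (lebesgue_Rn k)
  end.

Lemma lebesgue_Rn_box n (A : 'I_n -> set (measurableTypeR R)) :
  (forall i, measurable (A i)) ->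
  lebesgue_Rn n [set x | forall i, A i (tnth x i)] =
  (\prod_(i < n) lebesgue_measure (A i))%E.
Proof.
elim: n A => [|n IHn] A mA.
  by rewrite big_ord0 /= diracE mem_set// => -[].
rewrite big_ord_recl -IHn//.
have mB : measurable
    [set x : Rn R n | forall i, A (lift ord0 i) (tnth x i)].
  rewrite (_ : mkset _ = \bigcap_(i in [set: 'I_n])
      ((fun x : Rn R n => tnth x i) @^-1` A (lift ord0 i))); last first.
    by apply/seteqP; split => [x xA i _|x xA i]; [exact: xA|exact: (xA i)].
  apply: fin_bigcap_measurable => [|i _]; first exact: finite_finset.
  by rewrite -[X in measurable X]setTI; exact: measurable_tnth.
rewrite -product_measure2E//= /lebesgue_Rn_succ /pushforward; congr product_measure2.
apply/seteqP; split => [[x t] /= xtA|[x t] /= [xA tA] i].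
  by split; [exact: (xtA ord0)|move=> i; have := xtA (lift ord0 i); rewrite tnthS].
by case: (unliftP ord0 i) => [j|] ->; rewrite ?tnthS.
Qed.

End lebesgue_measure_on_Rn.
Arguments lebesgue_Rn : clear implicits.

Section weights.
Context {R : realType} {n : nat}.
Local Notation mu := (lebesgue_Rn R n).

Definition euclid_dist (x y : Rn R n) : R :=
  Num.sqrt (\sum_(i < n) (tnth x i - tnth y i) ^+ 2).

Definition euclid_ball (x : Rn R n) (r : R) : set (Rn R n) :=
  [set y | euclid_dist x y < r].

(* |B| for B = B(x, r) *)
Definition vol (x : Rn R n) (r : R) : R := fine (mu (euclid_ball x r)).

(* Local integrability is integrability on every ball, equivalently on every
   compact set; mu.-integrable includes the measurability of v on the ball. *)
Definition weight (v : Rn R n -> R) : Prop :=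
  (forall x, 0 < v x) /\
  (forall x r, mu.-integrable (euclid_ball x r) (EFin \o v)).

Definition Linfty_norm (f : Rn R n -> R) : \bar R := 'N[mu]_+oo[EFin \o f]%E.

(* In the two factors below, q is p_i' and lies in [1, +oo]; q = +oo is p_i = 1.
   The exponent theta is n - beta_i + delta / m. *)
Definition H_factor (v : Rn R n -> R) (q : \bar R) (theta : R)
    (x : Rn R n) (r : R) : \bar R :=
  let D y := vol x r `^ n%:R^-1 + euclid_dist x y in
  match q with
  | s%:E =>
      ((\int[mu]_y (v y `^ (- s) / D y `^ (theta * s))%R%:E) `^ s^-1%R)%E
  | _ => Linfty_norm (fun y => (v y)^-1 / D y `^ theta)
  end.

Definition A_factor (v : Rn R n -> R) (q : \bar R) (x : Rn R n) (r : R) :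
    \bar R :=
  match q with
  | s%:E =>
      (((vol x r)^-1%R%:E * \int[mu]_(y in euclid_ball x r) (v y `^ (- s))%R%:E)
        `^ s^-1%R)%E
  | _ => Linfty_norm (fun y => (v y)^-1 * \1_(euclid_ball x r) y)
  end.

Section multilinear.
Context {m : nat}.
Implicit Types (v : 'I_m -> Rn R n -> R) (p : 'I_m -> \bar R).

(* (w, v) \in H_m(p, beta, dt), with d the fixed parameter delta, dt the
   parameter delta tilde, and b the vector (beta_1, ..., beta_m). *)
Definition Hm_pair (w : Rn R n -> R) v p (b : 'I_m -> R) (d dt : R) : Prop :=
  exists2 C : R, 0 < C & forall (x : Rn R n) (r : R), 0 < r ->
    (Linfty_norm (fun y => w y * \1_(euclid_ball x r) y)%R
       / (vol x r `^ ((dt - d) / n%:R))%R%:E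
     * \prod_(i < m) H_factor (v i) (hoelder_conjugate (p i))
                       (n%:R - b i + d / m%:R)%R x r <= C%:E)%E.

Definition Hm v p (beta d dt : R) : Prop :=
  Hm_pair (fun y => \prod_(i < m) v i y) v p (fun=> beta / m%:R) d dt.

Definition A_pinfty v p : Prop :=
  (ereal_sup [set a | exists (x : Rn R n) (r : R), (0 < r)%R /\
     a = Linfty_norm
           (fun y => \1_(euclid_ball x r) y * \prod_(i < m) v i y)%R
         * \prod_(i < m) A_factor (v i) (hoelder_conjugate (p i)) x r]
   < +oo)%E.

(* 1/p = 1/p_1 + ... + 1/p_m, where 1/oo = 0. Scaling forces dt = beta - n/p in
   the one-weight class Hm: for any other dt no vector of weights is in it,
   while constant weights always satisfy A_pinfty. *)
Definition inv_p p : R := \sum_(i < m) fine (p i)^-1%E.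

End multilinear.
End weights.

(* Main.v *)
Require Import Defs.
From mathcomp Require Import all_boot all_order all_algebra.
From mathcomp Require Import all_classical all_reals all_analysis.
From mathcomp Require Import measurable_realfun ess_sup_inf lra ring.
Import Order.TTheory GRing.Theory Num.Theory.
Import numFieldNormedType.Exports.
Local Open Scope classical_set_scope.
Local Open Scope ring_scope.

(* Put q_i = p_i', t = n - beta/m + delta/m, s = n * sum_i 1/q_i, and let N_i(B)
   be the norm of v_i^-1 in L^(q_i)(B) and W(B) the essential supremum of
   prod_i v_i over B.

   H_m implies A: on B = B(x, R) the kernel |B|^(1/n) + |x - y| is comparable to
   R, so H_m gives W(B) prod_i (average of v_i^-1 on B) <= C R^gamma, where
   gamma = dt - (beta - n/p). The left-hand side is bounded below by a positive
   constant (Chebyshev), so gamma = 0, by letting R tend to 0 or to infinity.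

   A implies H_m: when dt = beta - n/p, the hypothesis dt < tau says exactly
   that s < t. Fix s <= e < t. Splitting R^n into dyadic annuli bounds the i-th
   factor of H_m by C R^(-t) sup_k 2^(-k e) N_i(2^k B). For any k_1, ..., k_m
   with maximum k, prod_i 2^(-k_i e) N_i(2^(k_i) B) is at most
   2^(-k e) prod_i N_i(2^k B), which A bounds by C 2^(-k e) (2^k R)^s / W(2^k B),
   hence by C R^s / W(B). *)

(** The extreme value of the power is at [b * r] when [0 <= t] and at [a * r] when [t < 0]; adding
    the two constants gives one bound for either sign. *)
Lemma powR_comparable (R : realType) (a b : R) : 0 < a -> a <= b -> forall t r s,
  0 < r -> a * r <= s <= b * r -> s `^ t <= (a `^ t + b `^ t) * r `^ t.
Proof.
move=> a0 ab t r s r0 /andP[ars sbr].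
have b0 := lt_le_trans a0 ab.
have ar0 : 0 < a * r by rewrite mulr_gt0.
have s0 : 0 < s by rewrite (lt_le_trans ar0).
rewrite mulrDl -!powRM ?(ltW a0) ?(ltW b0) ?(ltW r0)//; have [t0|t0] := leP 0 t.
  apply: (@le_trans _ _ ((b * r) `^ t)).
    by rewrite ge0_ler_powR// nnegrE ltW// (lt_le_trans s0).
  by rewrite lerDr powR_ge0.
apply: (@le_trans _ _ ((a * r) `^ t)); last by rewrite lerDl powR_ge0.
rewrite -[t]opprK powRN [leRHS]powRN lef_pV2 ?posrE ?powR_gt0//.
by rewrite ge0_ler_powR ?nnegrE ?oppr_ge0 ?(ltW t0) ?(ltW ar0) ?(ltW s0).
Qed.

(** * Volumes of Euclidean balls *)

Section euclidean_balls.
Context {R : realType} {n : nat}.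
Implicit Types (x y : Rn R n) (r : R).
Local Notation mu := (lebesgue_Rn R n).

Lemma euclid_dist_ge0 x y : 0 <= euclid_dist x y.
Proof. exact: sqrtr_ge0. Qed.

Lemma measurable_euclid_dist x : measurable_fun [set: Rn R n] (euclid_dist x).
Proof.
apply: (measurableT_comp (continuous_measurable_fun (@sqrt_continuous R))).
apply: measurable_sum => i; apply: measurable_funX.
by apply: measurable_funB => //; exact: measurable_tnth.
Qed.

Lemma measurable_euclid_ball x r : measurable (euclid_ball x r).
Proof.
have := measurable_euclid_dist x measurableT _ (measurable_itv `]-oo, r[).
by rewrite setTI; congr measurable; apply/seteqP; split => y; rewrite /= in_itv.
Qed.

Lemma euclid_ballS x r r' : r <= r' -> euclid_ball x r `<=` euclid_ball x r'.
Proof. by move=> rr' y xy; exact: lt_le_trans rr'. Qed.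

Lemma coord_le_euclid_dist x y i : `|tnth x i - tnth y i| <= euclid_dist x y.
Proof.
rewrite -sqrtr_sqr ler_wsqrtr// (bigD1 i)//= lerDl.
by apply: sumr_ge0 => j _; exact: sqr_ge0.
Qed.

(** Ball of the sup norm. The product formula gives its measure exactly, so cubes inside and around
    a Euclidean ball estimate the volume of that ball. *)
Definition cube x r : set (Rn R n) :=
  [set y | forall i, tnth y i \in `]tnth x i - r, tnth x i + r[].

Lemma measure_cube x r : 0 < r -> mu (cube x r) = ((r *+ 2) ^+ n)%:E.
Proof.
move=> r0.
have := @lebesgue_Rn_box R n (fun i => `]tnth x i - r, tnth x i + r[%classic) (fun=> measurable_itv _).
rewrite /cube => -> //.
rewrite (eq_bigr (fun=> (r *+ 2)%:E)); last first.
  move=> i _; rewrite lebesgue_measure_itv/= lte_fin ifT.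
    by rewrite -EFinB; congr (_%:E); lra.
  by lra.
by rewrite prodEFin prodr_const card_ord.
Qed.

Lemma measurable_cube x r : measurable (cube x r).
Proof.
rewrite (_ : cube x r = \bigcap_(i in [set: 'I_n])
   ((fun y : Rn R n => tnth y i) @^-1` `]tnth x i - r, tnth x i + r[)).
  apply: fin_bigcap_measurable => [|i _]; first exact: finite_finset.
  by rewrite -[X in measurable X]setTI; exact: measurable_tnth.
by apply/seteqP; split => [y yA i _|y yA i]; [exact: yA|exact: (yA i)].
Qed.

Lemma euclid_ball_sub_cube x r : euclid_ball x r `<=` cube x r.
Proof.
move=> y xy i; rewrite in_itv/=.
have := le_lt_trans (coord_le_euclid_dist x y i) xy.
by rewrite ltr_norml => /andP[? ?]; apply/andP; split; lra.
Qed.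

(** With half-side [e = r / (2n)], the squared distance is at most [n e^2], which is below
    [(2 n e)^2 = r^2]. *)
Lemma cube_sub_euclid_ball x r : (0 < n)%N -> 0 < r ->
  cube x (r / (n%:R *+ 2)) `<=` euclid_ball x r.
Proof.
move=> n0 r0 y xy; rewrite /euclid_ball/= /euclid_dist.
have n1 : 1 <= n%:R :> R by rewrite ler1n.
rewrite -[ltRHS]gtr0_norm// -sqrtr_sqr ltr_sqrt ?exprn_gt0//.
set e := r / _ in xy *; have e0 : 0 < e by rewrite divr_gt0// mulrn_wgt0 ?ltr0n.
have re : r = e * (n%:R *+ 2).
  by rewrite /e divfK// mulrn_eq0/= pnatr_eq0 -lt0n.
clearbody e; apply: (@le_lt_trans _ _ (\sum_(i < n) e ^+ 2)).
  apply: ler_sum => i _; rewrite -real_normK ?num_real// lerXn2r ?nnegrE// ?ltW//.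
  by have := xy i; rewrite in_itv/= ltr_norml => /andP[? ?]; apply/andP; split; lra.
rewrite sumr_const card_ord re exprMn -[ltLHS]mulr_natr ltr_pM2l ?exprn_gt0//.
nra.
Qed.

Lemma measure_euclid_ball_bounds x r : (0 < n)%N -> 0 < r ->
  (((r / n%:R) ^+ n)%:E <= mu (euclid_ball x r) <= ((r *+ 2) ^+ n)%:E)%E.
Proof.
move=> n0 r0; apply/andP; split.
  rewrite [leLHS](_ : _ = mu (cube x (r / (n%:R *+ 2)))).
    apply: le_measure; rewrite ?inE.
    - exact: measurable_cube.
    - exact: measurable_euclid_ball.
    - exact: cube_sub_euclid_ball.
  rewrite measure_cube; last by rewrite divr_gt0// mulrn_wgt0 ?ltr0n.
  congr (_ ^+ _)%:E; rewrite -[in RHS]mulr_natr -[_ *+ 2]mulr_natr.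
  by field; rewrite pnatr_eq0 -lt0n n0.
rewrite -(measure_cube x)//; apply: le_measure; rewrite ?inE.
- exact: measurable_euclid_ball.
- exact: measurable_cube.
- exact: euclid_ball_sub_cube.
Qed.

Hypothesis n_gt0 : (0 < n)%N.

Lemma measure_euclid_ball x r : 0 < r -> mu (euclid_ball x r) = (vol x r)%:E.
Proof.
move=> r0; have /andP[le ge] := measure_euclid_ball_bounds x r n_gt0 r0.
by rewrite fineK// ge0_fin_numE// (le_lt_trans ge)// ltry.
Qed.

Lemma vol_bounds x r : 0 < r -> (r / n%:R) ^+ n <= vol x r <= (r *+ 2) ^+ n.
Proof.
move=> r0; have := measure_euclid_ball_bounds x r n_gt0 r0.
by rewrite measure_euclid_ball// !lee_fin.
Qed.

Lemma vol_gt0 x r : 0 < r -> 0 < vol x r.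
Proof.
move=> r0; have /andP[+ _] := vol_bounds x r r0.
by apply: lt_le_trans; rewrite exprn_gt0// divr_gt0// ltr0n.
Qed.

Lemma measure_setT_gt0 : (0 < mu [set: Rn R n])%E.
Proof.
pose x : Rn R n := [tuple 0 | i < n].
apply: (@lt_le_trans _ _ (mu (euclid_ball x 1))).
  by rewrite measure_euclid_ball// lte_fin vol_gt0.
by apply: le_measure; rewrite ?inE//; exact: measurable_euclid_ball.
Qed.

Lemma vol_root_bounds x r : 0 < r ->
  r / n%:R <= vol x r `^ n%:R^-1 <= r *+ 2.
Proof.
move=> r0; have /andP[le ge] := vol_bounds x r r0.
have rn0 : 0 <= r / n%:R by rewrite divr_ge0 ?(ltW r0).
have r20 : 0 <= r *+ 2 by rewrite mulrn_wge0 ?(ltW r0).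
have rootK (a : R) : 0 <= a -> (a ^+ n) `^ n%:R^-1 = a.
  by move=> a0; rewrite -powR_mulrn// -powRrM divff ?powRr1// pnatr_eq0 -lt0n.
rewrite -(rootK _ rn0) -[r *+ 2](rootK _ r20).
by rewrite !ge0_ler_powR ?nnegrE ?invr_ge0 ?exprn_ge0// ?(ltW (vol_gt0 _ _ r0)).
Qed.

Lemma vol_root_gt0 x r : 0 < r -> 0 < vol x r `^ n%:R^-1.
Proof. by move=> r0; rewrite powR_gt0// vol_gt0. Qed.

(** Follows from [r / n <= |B|^(1/n) <= 2 r], with [K] uniform over all balls. Every sign of [a] is
    allowed, since volumes occur both as factors and as divisors. *)
Lemma vol_powR_le (a : R) : exists2 K : R, 0 < K &
  forall x r, 0 < r -> vol x r `^ (a / n%:R) <= K * r `^ a.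
Proof.
have n0 : 0 < n%:R :> R by rewrite ltr0n.
exists (n%:R^-1 `^ a + 2 `^ a); first by rewrite addr_gt0// powR_gt0 ?invr_gt0.
move=> x r r0; rewrite mulrC powRrM; apply: powR_comparable => //.
- by rewrite invr_gt0.
- by rewrite invf_ple ?posrE//; apply: (@le_trans _ _ 1); rewrite ?ler1n//; lra.
- by rewrite mulrC mulr_natl vol_root_bounds.
Qed.

End euclidean_balls.

(** * Powers of extended reals and powers of two *)

Lemma le_poweR {R : realType} (x y : \bar R) (a : R) :
  0 <= a -> (0 <= x)%E -> (x <= y)%E -> (x `^ a <= y `^ a)%E.
Proof.
move=> a0 x0 xy; apply: gt0_ler_poweR => //; rewrite in_itv/= leey andbT//.
exact: le_trans xy.
Qed.

Lemma poweR_inv_le {R : realType} (x : \bar R) (a s : R) :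
  0 < s -> (0 <= x)%E -> 0 <= a ->
  (x `^ s^-1 <= a%:E)%E = (x <= (a `^ s)%:E)%E.
Proof.
move=> s0 x0 a0; apply/idP/idP => [xa|xa].
  have -> : x = ((x `^ s^-1) `^ s)%E by rewrite -poweRrM mulVf ?gt_eqF// poweRe1.
  by rewrite -poweR_EFin le_poweR ?poweR_ge0// ltW.
have -> : a = (a `^ s) `^ s^-1 by rewrite -powRrM divff ?gt_eqF// powRr1.
by rewrite -poweR_EFin le_poweR// invr_ge0 ltW.
Qed.

Lemma exists_lt_exp2 {R : realType} (a b : R) : 0 < b -> exists k, a < 2 ^+ k * b.
Proof.
move=> b0; exists (Num.truncn (a / b)).+1; rewrite -ltr_pdivrMr//.
apply: (lt_trans (archimedean.Num.Theory.truncnS_gt _)).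
by rewrite -natrX ltr_nat ltn_expl.
Qed.

(** * Norms of a single weight on balls *)

Section weights.
Context {R : realType} {n : nat}.
Hypothesis n_gt0 : (0 < n)%N.
Implicit Types (x y : Rn R n) (r a : R) (q : \bar R) (v : Rn R n -> R).
Local Notation mu := (lebesgue_Rn R n).

(** The norm is defined by cases on whether the whole space has positive mass; [measure_setT_gt0]
    selects the essential supremum. *)
Lemma Linfty_normP (f : Rn R n -> R) (c : \bar R) :
  (Linfty_norm f <= c)%E <-> {ae mu, forall y, (`|f y|%:E <= c)%E}.
Proof.
rewrite /Linfty_norm unlock /Lnorm measure_setT_gt0//.
by split => [/ess_supP|fc]; [|exact/ess_supP].
Qed.

(** Integrability on a ball includes measurability there, and countably many concentric balls
    exhaust the space. *)
Lemma measurable_weight v : weight v -> measurable_fun [set: Rn R n] v.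
Proof.
move=> [_ iv]; pose o : Rn R n := [tuple 0 | i < n].
have -> : [set: Rn R n] = \bigcup_k euclid_ball o k%:R.
  apply/seteqP; split => // y _; exists (Num.truncn (euclid_dist o y)).+1 => //.
  exact: archimedean.Num.Theory.truncnS_gt.
apply/measurable_fun_bigcup => k; first exact: measurable_euclid_ball.
by apply/measurable_EFinP; exact: measurable_int (iv o k%:R).
Qed.

Lemma measurable_weight_powR v a : weight v ->
  measurable_fun [set: Rn R n] (fun y => (v y `^ a)%:E).
Proof.
move=> /measurable_weight mv; apply/measurable_EFinP.
exact: measurableT_comp (measurable_powR _) mv.
Qed.

(* The norm of v^-1 in L^q(B), for B = B(x, r). *)
Definition ball_norm v q x r : \bar R :=
  match q with
  | s%:E => ((\int[mu]_(y in euclid_ball x r) (v y `^ (- s))%:E) `^ s^-1)%E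
  | _ => Linfty_norm (fun y => (v y)^-1 * \1_(euclid_ball x r) y)
  end.

(** The value at [+oo] is 0, so in both branches [A_factor] and [ball_norm] differ by the same power
    of the volume. *)
Definition inv_exponent q : R := fine q^-1%E.

Lemma A_factorE v q x r : (1 <= q)%E -> 0 < r ->
  A_factor v q x r = ((vol x r `^ (- inv_exponent q))%:E * ball_norm v q x r)%E.
Proof.
rewrite /inv_exponent; case: q => [s|_|]// => [|r0]; last first.
  by rewrite invey/= oppr0 powRr0 mul1e.
rewrite lee_fin => s1 r0; rewrite fine_invr /A_factor /ball_norm.
have v0 := vol_gt0 n_gt0 x r r0.
rewrite poweRM ?lee_fin ?invr_ge0 ?(ltW v0)//; last first.
  by apply: integral_ge0 => y _; rewrite lee_fin powR_ge0.
by rewrite poweR_EFin -powR_inv1 ?(ltW v0)// -powRrM mulN1r.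
Qed.

Lemma ball_norm_ge0 v q x r : (0 <= ball_norm v q x r)%E.
Proof. by case: q => [s||]; [exact: poweR_ge0|exact: Lnorm_ge0..]. Qed.

(** If the norm vanished, a strictly positive function would be zero almost everywhere on a ball,
    which has positive measure. *)
Lemma ball_norm_gt0 v q x r : weight v -> (1 <= q)%E -> 0 < r ->
  (0 < ball_norm v q x r)%E.
Proof.
move=> wv q1 r0; have mB := measurable_euclid_ball x r.
rewrite lt_neqAle ball_norm_ge0 andbT eq_sym; apply/negP => /eqP N0.
suff [Z [mZ Z0 BZ]] : mu.-negligible (euclid_ball x r).
  have : (mu (euclid_ball x r) <= mu Z)%E by apply: le_measure; rewrite ?inE.
  by rewrite [X in (_ <= X)%E]Z0 measure_euclid_ball// lee_fin leNgt vol_gt0.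
case: q q1 N0 => [s|_|]//.
  rewrite lee_fin => s1 /poweR_eq0_eq0.
  have I0 : (0 <= \int[mu]_(y in euclid_ball x r) (v y `^ (- s))%:E)%E.
    by apply: integral_ge0 => y _; rewrite lee_fin powR_ge0.
  move=> /(_ I0) I00.
  have : (\int[mu]_(y in euclid_ball x r) `|(v y `^ (- s))%:E| = 0)%E.
    by rewrite -[RHS]I00; apply: eq_integral => y _; rewrite gee0_abs// lee_fin powR_ge0.
  move/ae_eq_integral_abs => /(_ mB) [|Z [mZ Z0 BZ]].
    exact: measurable_funS (measurable_weight_powR _ (- s) wv).
  exists Z; split => // y By; apply: BZ => /(_ By) /eqP.
  by rewrite /= eqe gt_eqF// powR_gt0//; case: wv.
move=> /= N0; have /Linfty_normP [Z [mZ Z0 BZ]] : 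
  (Linfty_norm (fun y => (v y)^-1 * \1_(euclid_ball x r) y)%R <= 0)%E by rewrite N0.
exists Z; split => // y By; apply: BZ; apply/negP.
rewrite lee_fin indicE mem_set// mulr1 -ltNge normr_gt0 invr_eq0 gt_eqF//.
by case: wv.
Qed.

Lemma ball_norm_le v q x r r' : weight v -> (1 <= q)%E -> r <= r' ->
  (ball_norm v q x r <= ball_norm v q x r')%E.
Proof.
move=> wv q1 rr'; have BB := euclid_ballS x r r' rr'.
case: q q1 => [s|_|]//.
  rewrite lee_fin => s1; apply: le_poweR.
  - by rewrite invr_ge0 (le_trans _ s1).
  - by apply: integral_ge0 => y _; rewrite lee_fin powR_ge0.
  apply: ge0_subset_integral => //; try exact: measurable_euclid_ball.
  - exact: measurable_funS (measurable_weight_powR _ _ wv).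
  - by move=> y _; rewrite lee_fin powR_ge0.
apply/Linfty_normP.
have /Linfty_normP := lexx (Linfty_norm (fun y => (v y)^-1 * \1_(euclid_ball x r') y)).
apply: filterS => y; apply: le_trans; rewrite lee_fin !normrM ler_wpM2l//.
rewrite !indicE; have [/set_mem yB|_] := boolP (y \in euclid_ball x r).
  by rewrite mem_set//; exact: BB.
by rewrite normr0.
Qed.

(** On the ball the kernel [D] lies between [r / n] and [3 r], as the volume term is at most [2 r]
    and the distance at most [r]. Hence [D^t <= K r^t] there, and extending the integral or the
    essential supremum to the whole space only increases it. *)
Lemma ball_norm_le_H_factor (t : R) : exists2 K : R, 0 < K &
  forall v q x r, weight v -> (1 <= q)%E -> 0 < r ->
    (ball_norm v q x r <= (K * r `^ t)%:E * H_factor v q t x r)%E.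
Proof.
have nR0 : 0 < n%:R :> R by rewrite ltr0n.
have nR1 : 1 <= n%:R :> R by rewrite ler1n.
have inv_n : n%:R^-1 <= 3 :> R.
  by rewrite invf_ple ?posrE//; lra.
exists (n%:R^-1 `^ t + 3 `^ t); first by rewrite addr_gt0// powR_gt0 ?invr_gt0.
move=> v q x r wv q1 r0; set K := _ + _.
have /andP[Vl Vu] := vol_root_bounds n_gt0 x r r0.
have K0 : 0 < K * r `^ t by rewrite mulr_gt0 ?addr_gt0// powR_gt0 ?invr_gt0.
pose D y := vol x r `^ n%:R^-1 + euclid_dist x y.
have D0 y : 0 < D y by rewrite ltr_wpDr ?euclid_dist_ge0// vol_root_gt0.
have v0 : forall y, 0 < v y by case: wv.
have DK y : euclid_ball x r y -> D y `^ t <= K * r `^ t.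
  rewrite /euclid_ball/= => xyr; apply: powR_comparable => //.
    by rewrite invr_gt0.
  have := euclid_dist_ge0 x y; rewrite /D mulrC => ?.
  by apply/andP; split; lra.
case: q q1 => [s|_|]//.
  rewrite lee_fin => s1; have s0 : 0 < s by lra.
  have I0 : (0 <= \int[mu]_y (v y `^ (- s) / D y `^ (t * s))%:E)%E.
    by apply: integral_ge0 => y _; rewrite lee_fin divr_ge0 ?powR_ge0.
  have -> : (K * r `^ t)%:E = (((K * r `^ t) `^ s)%:E `^ s^-1)%E.
    by rewrite poweR_EFin -powRrM divff ?gt_eqF// powRr1// ltW.
  rewrite /ball_norm /H_factor -/D -poweRM ?lee_fin ?powR_ge0//.
  have mf : measurable_fun [set: Rn R n] (fun y => (v y `^ (- s) / D y `^ (t * s))%:E).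
    apply/measurable_EFinP; apply: measurable_funM.
      by apply/measurable_EFinP; exact: measurable_weight_powR.
    under eq_fun do rewrite -powRN.
    apply: (measurableT_comp (measurable_powR _)).
    by apply: measurable_funD => //; exact: measurable_euclid_dist.
  have mB := measurable_euclid_ball x r.
  apply: le_poweR; first by rewrite invr_ge0 ltW.
    by apply: integral_ge0 => y _; rewrite lee_fin powR_ge0.
  rewrite -ge0_integralZl_EFin ?powR_ge0//; last first.
    by move=> y _; rewrite lee_fin divr_ge0 ?powR_ge0.
  apply: (@le_trans _ _ (\int[mu]_(y in euclid_ball x r)
      (((K * r `^ t) `^ s)%:E * (v y `^ (- s) / D y `^ (t * s))%:E))%E).
    apply: ge0_le_integral => //.
    - by move=> y _; rewrite lee_fin powR_ge0.
    - exact: measurable_funS (measurable_weight_powR _ _ wv).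
    - by apply: measurable_funeM; exact: measurable_funS mf.
    move=> y By; rewrite lee_fin mulrCA ler_peMr ?powR_ge0//.
    rewrite ler_pdivlMr ?powR_gt0// mul1r powRrM ge0_ler_powR ?nnegrE ?powR_ge0//.
    - exact: ltW.
    - exact: ltW.
    - exact: DK.
  apply: ge0_subset_integral => //; first exact: measurable_funeM.
  by move=> y _; rewrite -EFinM lee_fin mulr_ge0 ?divr_ge0 ?powR_ge0.
rewrite /ball_norm /H_factor -/D; apply/Linfty_normP.
have /Linfty_normP := lexx (Linfty_norm (fun y => (v y)^-1 / D y `^ t)).
apply: filterS => y /(lee_wpmul2l (x := (K * r `^ t)%:E)); rewrite lee_fin.
move=> /(_ (ltW K0)); apply: le_trans; rewrite -EFinM lee_fin indicE.
have [/set_mem yB|_] := boolP (y \in euclid_ball x r); last first.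
  by rewrite mulr0 normr0 mulr_ge0// ltW.
rewrite mulr1 normrM mulrCA ler_peMr// ger0_norm ?invr_ge0 ?powR_ge0//.
by rewrite ler_pdivlMr ?powR_gt0// mul1r DK.
Qed.

End weights.

(** * Dyadic estimate of a factor of H_m *)

Lemma nneseries_geometric_le {R : realType} (a z : R) : 0 <= a -> 0 <= z < 1 ->
  (\sum_(0 <= k <oo) (a * z ^+ k)%:E <= (a / (1 - z))%:E)%E.
Proof.
move=> a0 /andP[z0 z1].
have az0 k : 0 <= a * z ^+ k by rewrite mulr_ge0// exprn_ge0.
apply: lime_le; first by apply: is_cvg_nneseries => k _ _; rewrite lee_fin.
apply: nearW => N; rewrite sumEFin lee_fin.
have -> : \sum_(0 <= k < N) a * z ^+ k = a * (1 - z ^+ N) / (1 - z).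
  have /geometric_seriesE/(congr1 (fun f => f N)) := negbT (lt_eqF z1).
  exact.
rewrite ler_wpM2r ?invr_ge0 ?subr_ge0 ?(ltW z1)// ler_piMr//.
by rewrite gerBl exprn_ge0.
Qed.

Section weight_estimates.
Context {R : realType} {n : nat}.
Hypothesis n_gt0 : (0 < n)%N.
Implicit Types (x y : Rn R n) (r a : R) (q : \bar R) (v : Rn R n -> R).
Local Notation mu := (lebesgue_Rn R n).

(** Take the least [k] with [|x - y| < 2^k r]. If [k = 0], the volume term alone is at least
    [r / n]; otherwise minimality gives [|x - y| >= 2^(k-1) r]. The constant [1 / (2n)] covers both
    cases. *)
Lemma dyadic_ball_cover x r y : 0 < r -> exists2 k,
  euclid_ball x (2 ^+ k * r) y &
  (n%:R *+ 2)^-1 * (2 ^+ k * r) <= vol x r `^ n%:R^-1 + euclid_dist x y.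
Proof.
move=> r0; have xyk := exists_lt_exp2 (euclid_dist x y) r r0.
have n1 : 1 <= n%:R :> R by rewrite ler1n.
have /andP[Vl _] := vol_root_bounds n_gt0 x r r0.
have d0 := euclid_dist_ge0 x y.
have n2 : 0 < n%:R *+ 2 :> R by lra.
exists (ex_minn xyk); case: ex_minnP => k // xyk1 kmin.
rewrite mulrC ler_pdivrMr//; move: Vl; rewrite ler_pdivrMr; last by lra.
set V := _ `^ _ => Vl.
case: k xyk1 kmin => [|k] xyk1 kmin.
  rewrite expr0 mul1r (le_trans Vl)//.
  apply: (@le_trans _ _ (V * (n%:R *+ 2))); last by rewrite ler_wpM2r ?lerDl// ltW.
  by rewrite ler_wpM2l ?powR_ge0//; lra.
have : ~~ (euclid_dist x y < 2 ^+ k * r).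
  by apply/negP => /kmin; rewrite ltnn.
rewrite -leNgt => kxy; rewrite exprS -mulrA.
apply: (@le_trans _ _ (euclid_dist x y * 2)); first by lra.
have V0 : 0 <= V by exact: powR_ge0.
by nra.
Qed.

(** At scale [k] the kernel contributes [(2^k r)^(-t)] and the norm [(2^k)^e S]; since [e < t] the
    contributions decay geometrically. The constant [K] depends only on [n], [t], [e] and [q]. *)
Lemma H_factor_le (t e : R) q : e < t -> 0 <= t -> (1 <= q)%E ->
  exists2 K : R, 0 < K & forall v x r S, weight v -> 0 < r -> 0 <= S ->
    (forall k, (ball_norm v q x (2 ^+ k * r) <= ((2 ^+ k) `^ e * S)%:E)%E) ->
    (H_factor v q t x r <= (K * r `^ (- t) * S)%:E)%E.
Proof.
move=> et t0; pose c : R := (n%:R *+ 2)^-1.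
have c0 : 0 < c by rewrite invr_gt0 mulrn_wgt0// ltr0n.
have pw2 k (a : R) : (2 ^+ k : R) `^ a = (2 `^ a) ^+ k.
  by rewrite -[RHS]powR_mulrn ?powR_ge0// -powRrM mulrC powRrM powR_mulrn.
have p2 k : 0 < 2 ^+ k :> R by rewrite exprn_gt0.
case: q => [s|_|]//; last first.
  exists (c `^ (- t)); first exact: powR_gt0.
  move=> v x r S wv r0 S0 NS; have v0 : forall y, 0 < v y by case: wv.
  apply/Linfty_normP => //.
  (* Countably many almost-everywhere bounds hold together off one null set, so the scale [k] may
     then depend on [y]. *)
  have /ae_foralln : forall k, {ae mu, forall y,
      (`|(v y)^-1 * \1_(euclid_ball x (2 ^+ k * r)) y|%:E <= ((2 ^+ k) `^ e * S)%:E)%E}.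
    by move=> k; apply/Linfty_normP => //; exact: NS.
  apply: filterS => y Hy.
  have [k yk ck] := dyadic_ball_cover x r y r0.
  set D := _ + _ in ck *.
  have ckr : 0 < c * (2 ^+ k * r) by rewrite !mulr_gt0.
  have D0 : 0 < D := lt_le_trans ckr ck.
  move: (Hy k); rewrite indicE mem_set// mulr1 !lee_fin => Hk.
  rewrite normrM ger0_norm in Hk *; rewrite ?invr_ge0 ?(ltW (v0 _))//.
  rewrite ger0_norm ?invr_ge0 ?powR_ge0// ler_pdivrMr ?powR_gt0//.
  apply: (le_trans Hk).
  have -> : c `^ (- t) * r `^ (- t) * S * D `^ t =
      S * ((c * r) `^ (- t) * D `^ t) by rewrite powRM ?ltW//; ring.
  rewrite mulrC ler_wpM2l//.
  have -> : (2 ^+ k : R) `^ e = (c * r) `^ (- t) * (((2 ^+ k) `^ e) * (c * r) `^ t).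
    by rewrite mulrCA -powRD ?addNr ?powRr0 ?mulr1//; apply/implyP => _; rewrite gt_eqF// mulr_gt0.
  rewrite ler_wpM2l ?powR_ge0//.
  apply: (@le_trans _ _ ((c * (2 ^+ k * r)) `^ t)); last first.
    by rewrite ge0_ler_powR ?nnegrE// ltW.
  rewrite mulrCA [leRHS]powRM ?(ltW (p2 _))//; last by rewrite mulr_ge0// ltW.
  rewrite ler_wpM2r ?powR_ge0// ler_powR ?(ltW et)//.
  by rewrite exprn_ege1// ler1n.
rewrite lee_fin => s1; have s0 : 0 < s by lra.
(* Common ratio of the series of s-th powers: [2^(- t s)] comes from the kernel and [2^(e s)] from
   the assumed growth. The constant [G] below is the sum of the series up to the factor
   [r^(- t s) S^s]. *)
pose z : R := 2 `^ (- ((t - e) * s)).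
have z0 : 0 < z by rewrite powR_gt0.
have z1 : z < 1.
  rewrite /z powRN invf_lt1 ?powR_gt0//.
  have : 0 < (t - e) * s by rewrite mulr_gt0// subr_gt0.
  move=> /gt0_ltr_powR/(_ _ _ _ _ (ltr1n R 2)); rewrite powR1; apply.
    by rewrite nnegrE.
  by rewrite nnegrE.
pose G := c `^ (- (t * s)) / (1 - z).
have G0 : 0 < G by rewrite divr_gt0 ?powR_gt0// subr_gt0.
exists (G `^ s^-1); first exact: powR_gt0.
move=> v x r S wv r0 S0 NS; have v0 : forall y, 0 < v y by case: wv.
have B0 : 0 <= G `^ s^-1 * r `^ (- t) * S by rewrite !mulr_ge0 ?powR_ge0.
rewrite /H_factor poweR_inv_le//; last first.
  by apply: integral_ge0 => y _; rewrite lee_fin divr_ge0 ?powR_ge0.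
have -> : (G `^ s^-1 * r `^ (- t) * S) `^ s = G * r `^ (- t * s) * S `^ s.
  rewrite powRM ?mulr_ge0 ?powR_ge0// powRM ?powR_ge0// -!powRrM.
  by rewrite mulVf ?gt_eqF// powRr1// ltW.
pose D y := vol x r `^ n%:R^-1 + euclid_dist x y.
pose a k := (c * (2 ^+ k * r)) `^ (- (t * s)).
pose g y : \bar R := (v y `^ (- s))%:E.
(* Whole balls replace annuli: their overlaps only enlarge a nonnegative sum, and the hypothesis
   controls the norms on balls. *)
pose f k y : \bar R := ((a k)%:E * (g \_ (euclid_ball x (2 ^+ k * r))) y)%E.
have gb0 k y : (0 <= (g \_ (euclid_ball x (2 ^+ k * r))) y)%E.
  by apply: erestrict_ge0 => ? _; rewrite lee_fin powR_ge0.
have f0 k y : (0 <= f k y)%E by rewrite mule_ge0// lee_fin powR_ge0.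
have mB k := measurable_euclid_ball x (2 ^+ k * r).
have mg k : measurable_fun [set: Rn R n] (g \_ (euclid_ball x (2 ^+ k * r))).
  apply/(measurable_restrictT _ (mB k)).
  exact: measurable_funS (measurable_weight_powR v (- s) wv).
have mf k : measurable_fun [set: Rn R n] (f k) by exact: measurable_funeM.
apply: (@le_trans _ _ (\int[mu]_y (\sum_(0 <= k <oo) f k y))%E).
  apply: ge0_le_integral => //.
  - by move=> y _; rewrite lee_fin divr_ge0 ?powR_ge0.
  - apply/measurable_EFinP; apply: measurable_funM.
      by apply/measurable_EFinP; exact: measurable_weight_powR.
    under eq_fun do rewrite -powRN.
    apply: (measurableT_comp (measurable_powR _)).
    by apply: measurable_funD => //; exact: measurable_euclid_dist.
  - exact: ge0_emeasurable_sum.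
  move=> y _; have [k yk ck] := dyadic_ball_cover x r y r0.
  have ckr : 0 < c * (2 ^+ k * r) by rewrite !mulr_gt0.
  have Dy0 : 0 < D y := lt_le_trans ckr ck.
  (* The single term at the scale [k] of [y] already dominates the integrand. *)
  apply: (@le_trans _ _ (\sum_(0 <= i < k.+1) f i y)%E); last exact: nneseries_lim_ge.
  rewrite big_nat_recr//=; apply: (@le_trans _ _ (f k y)); last first.
    by rewrite leeDr//; apply: sume_ge0 => i _; exact: f0.
  rewrite /f patchE mem_set// /g -EFinM lee_fin mulrC ler_wpM2r ?powR_ge0//.
  rewrite /a powRN lef_pV2 ?posrE ?powR_gt0//.
  by rewrite ge0_ler_powR ?nnegrE// ?mulr_ge0 ?(ltW s0)// ltW.
rewrite integral_nneseries//.
apply: (@le_trans _ _ (\sum_(0 <= k <oo)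
    ((c `^ (- (t * s)) * r `^ (- t * s) * S `^ s) * z ^+ k)%:E)%E); last first.
  apply: le_trans.
    by apply: nneseries_geometric_le; rewrite ?mulr_ge0 ?powR_ge0// (ltW z0).
  by rewrite lee_fin /G le_eqVlt; apply/orP; left; apply/eqP; ring.
apply: lee_nneseries => [k _ _|k _].
  by apply: integral_ge0 => y _; exact: f0.
rewrite /f ge0_integralZl_EFin ?powR_ge0// -integral_mkcond.
have := NS k; rewrite /ball_norm poweR_inv_le ?mulr_ge0 ?powR_ge0//; last first.
  by apply: integral_ge0 => y _; rewrite lee_fin powR_ge0.
move=> /(@lee_wpmul2l _ (a k)%:E); rewrite lee_fin powR_ge0 => /(_ isT).
move=> /le_trans; apply; rewrite -EFinM lee_fin /a.
rewrite !powRM ?powR_ge0 ?mulr_ge0 ?(ltW r0) ?(ltW c0) ?(ltW (p2 k))//.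
rewrite -powRrM mulNr.
rewrite le_eqVlt; apply/orP; left; apply/eqP.
have -> : z ^+ k = (2 ^+ k) `^ (- (t * s)) * (2 ^+ k) `^ (e * s).
  rewrite -pw2 -powRD; last by apply/implyP => _; rewrite gt_eqF.
  by congr (_ `^ _); ring.
ring.
Qed.

End weight_estimates.

(** * Products of nonnegative extended reals *)

Lemma prode_le {R : realType} (I : Type) (s : seq I) (F G : I -> \bar R) :
  (forall i, 0 <= F i)%E -> (forall i, F i <= G i)%E ->
  (\prod_(i <- s) F i <= \prod_(i <- s) G i)%E.
Proof.
move=> F0 FG; suff /andP[] : (0 <= \prod_(i <- s) F i <= \prod_(i <- s) G i)%E by [].
elim/big_rec2: _ => [|i y x _ /andP[x0 xy]]; first by rewrite lee01 lexx.
by rewrite mule_ge0//= lee_pmul.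
Qed.

Lemma prode_gt0 {R : realType} (I : Type) (s : seq I) (P : pred I) (F : I -> \bar R) :
  (forall i, 0 < F i)%E -> (0 < \prod_(i <- s | P i) F i)%E.
Proof.
by move=> F0; elim/big_rec: _ => [|i x _ x0]; [rewrite lte01|rewrite mule_gt0].
Qed.

(** Positivity of [y] rules out the convention [+oo * 0 = 0]. *)
Lemma mule_lty_gt0 {R : realType} (x y : \bar R) :
  (0 < x -> 0 < y -> x * y < +oo -> x < +oo)%E.
Proof. by case: x => // [x|] x0 y0; rewrite ?ltry// gt0_mulye. Qed.

Lemma prode_lty_gt0 {R : realType} (I : finType) (F : I -> \bar R) :
  (forall i, 0 < F i)%E -> (\prod_i F i < +oo)%E -> forall i, (F i < +oo)%E.
Proof.
move=> F0 + i; rewrite (bigD1 i)//=; apply: mule_lty_gt0 => //.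
exact: prode_gt0.
Qed.

(** * A universal lower bound for the A-product *)

Section lower_bound.
Context {R : realType} {n : nat}.
Hypothesis n_gt0 : (0 < n)%N.
Implicit Types (x y : Rn R n) (r a : R) (q : \bar R) (v : Rn R n -> R).
Local Notation mu := (lebesgue_Rn R n).

Lemma A_factor_ge0 v q x r : (1 <= q)%E -> 0 < r -> (0 <= A_factor v q x r)%E.
Proof.
by move=> q1 r0; rewrite A_factorE// mule_ge0 ?ball_norm_ge0// lee_fin powR_ge0.
Qed.

Lemma A_factor_gt0 v q x r : weight v -> (1 <= q)%E -> 0 < r ->
  (0 < A_factor v q x r)%E.
Proof.
move=> wv q1 r0; rewrite A_factorE// mule_gt0 ?ball_norm_gt0// lte_fin powR_gt0//.
exact: vol_gt0.
Qed.

(* Chebyshev's inequality, uniform in q: E is a null set when q = +oo. *)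
Lemma A_factor_weak_type v q x r a l : weight v -> (1 <= q)%E -> 0 < r ->
  0 < a -> 1 <= l -> (A_factor v q x r <= a%:E)%E ->
  exists E : set (Rn R n), [/\ measurable E, (mu E <= (vol x r / l)%:E)%E &
    forall y, euclid_ball x r y -> ~ E y -> (v y)^-1 <= l * a].
Proof.
move=> wv + r0 a0 l1; have v0 : forall y, 0 < v y by case: wv.
have l0 : 0 < l by lra.
have V0 := vol_gt0 n_gt0 x r r0.
have mB := measurable_euclid_ball x r.
case: q => [s|_|]//; last first.
  move=> /Linfty_normP-/(_ n_gt0)[E [mE E0 aE]]; exists E; split => //.
    by rewrite [leLHS]E0 lee_fin divr_ge0 ?ltW.
  move=> y By /contra_notP; apply => Ny; apply: aE => /=; apply: contra_not Ny.
  rewrite indicE mem_set// mulr1 lee_fin => Ha.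
  by rewrite (le_trans (ler_norm _))// (le_trans Ha)// ler_peMl// ltW.
rewrite lee_fin => s1 As; have s0 : 0 < s by lra.
pose g y : \bar R := (v y `^ (- s))%:E.
have g0 y : (0 <= g y)%E by rewrite lee_fin powR_ge0.
have mg : measurable_fun (euclid_ball x r) g.
  exact: measurable_funS (measurable_weight_powR v (- s) wv).
have Ig : (\int[mu]_(y in euclid_ball x r) `|g y| <= (vol x r * a `^ s)%:E)%E.
  under eq_integral do rewrite gee0_abs//.
  move: As; rewrite /A_factor poweR_inv_le ?(ltW a0)//; last first.
    by rewrite mule_ge0 ?lee_fin ?invr_ge0 ?(ltW V0)//; apply: integral_ge0 => y _; exact: g0.
  by rewrite lee_pdivrMl// -EFinM.
have la0 : 0 < (l * a) `^ s by rewrite powR_gt0// mulr_gt0.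
exists (euclid_ball x r `&` [set y | ((l * a) `^ s)%:E <= `|g y|]%E); split.
- by apply: emeasurable_fun_c_infty => //; exact: measurableT_comp.
- have := le_trans (le_integral_abse mu mB mg la0) Ig.
  rewrite -lee_pdivlMl// => /le_trans; apply; rewrite -EFinM lee_fin.
  have -> : ((l * a) `^ s)^-1 * (vol x r * a `^ s) = vol x r / l `^ s.
    by rewrite powRM ?(ltW l0) ?(ltW a0)//; field; rewrite !gt_eqF ?powR_gt0.
  (* Uniformity in [q]: [1 <= l] and [1 <= s] give [l <= l^s]. *)
  rewrite ler_wpM2l ?(ltW V0)// lef_pV2 ?posrE ?powR_gt0//.
  exact: le1r_powR.
move=> y By /not_andP[//|/negP]; rewrite -ltNge gee0_abs// lte_fin => gy.
rewrite leNgt; apply/negP => lav; move: gy; rewrite ltNge => /negP; apply.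
have -> : v y `^ (- s) = (v y)^-1 `^ s.
  by rewrite -powR_inv1 ?ltW// -powRrM mulN1r.
by rewrite ge0_ler_powR ?nnegrE ?invr_ge0 ?mulr_ge0 ?ltW.
Qed.

(* The exceptional sets where some v_i^-1 exceeds 2m times its average fill at
   most half of the ball. *)
Lemma A_pinfty_product_ge m (v : 'I_m -> Rn R n -> R) (q : 'I_m -> \bar R) x r :
  (0 < m)%N -> (forall i, weight (v i)) -> (forall i, 1 <= q i)%E -> 0 < r ->
  ((((m%:R *+ 2) ^+ m)^-1)%:E <=
   Linfty_norm (fun y => \1_(euclid_ball x r) y * \prod_(i < m) v i y)%R
     * \prod_(i < m) A_factor (v i) (q i) x r)%E.
Proof.
move=> m0 wv q1 r0; set W := Linfty_norm _.
have mR0 : 0 < m%:R *+ 2 :> R by rewrite mulrn_wgt0 ?ltr0n.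
have mR1 : 1 <= m%:R *+ 2 :> R.
  by have : 1 <= m%:R :> R; [rewrite ler1n|lra].
have v0 i y : 0 < v i y by case: (wv i).
have V0 := vol_gt0 n_gt0 x r r0.
have mB := measurable_euclid_ball x r.
have A0 i : (0 < A_factor (v i) (q i) x r)%E by exact: A_factor_gt0.
have W0 : (0 <= W)%E by exact: Lnorm_ge0.
set P := (\prod_(i < m) _)%E.
have P0 : (0 < P)%E by exact: prode_gt0.
have [->|Wfin] := eqVneq W +oo%E; first by rewrite gt0_mulye// leey.
have {}Wfin : W \is a fin_num by rewrite ge0_fin_numE// ltey.
have /Linfty_normP-/(_ n_gt0) [Z [mZ Z0 WZ]] := lexx W.
have [Py|Pfin] := eqVneq P +oo%E.
  (* Since [0 * +oo] is 0 by convention, [W = 0] has to be excluded: the positive product of the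
     weights would vanish almost everywhere on the ball. *)
  have [W00|] := eqVneq W 0%E; last first.
    by move=> Wn0; rewrite Py gt0_muley ?leey// lt0e Wn0.
  exfalso; have : (mu (euclid_ball x r) <= mu Z)%E.
    apply: le_measure; rewrite ?inE// => y By; apply: WZ => /=; apply/negP.
    rewrite W00 lee_fin indicE mem_set// mul1r -ltNge normr_gt0 gt_eqF//.
    exact: prodr_gt0.
  rewrite [X in (_ <= X)%E]Z0 measure_euclid_ball//.
  by rewrite lee_fin leNgt V0.
have {}Pfin i : A_factor (v i) (q i) x r \is a fin_num.
  rewrite ge0_fin_numE ?ltW//; move: i; apply: prode_lty_gt0 => //.
  by rewrite ltey.
pose a i := fine (A_factor (v i) (q i) x r).
have aE i : A_factor (v i) (q i) x r = (a i)%:E by rewrite fineK.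
have a0 i : 0 < a i by rewrite -lte_fin -aE.
have /choice[E HE] : forall i, exists E : set (Rn R n), [/\ measurable E,
    (mu E <= (vol x r / (m%:R *+ 2))%:E)%E &
    forall y, euclid_ball x r y -> ~ E y -> (v i y)^-1 <= (m%:R *+ 2) * a i].
  by move=> i; apply: (@A_factor_weak_type _ (q i)) => //; rewrite aE.
pose U := \big[setU/set0]_(i < m) E i.
have [mU muU] : measurable U /\ (mu U <= (vol x r / 2)%:E)%E.
  have mU : measurable U by apply: bigsetU_measurable => i _; have [] := HE i.
  split => //; apply: (@le_trans _ _ (\sum_(i < m) (vol x r / (m%:R *+ 2))%:E)%E).
    rewrite /U; suff [] : measurable (\big[setU/set0]_(i < m) E i) /\
      (mu (\big[setU/set0]_(i < m) E i) <=
       \sum_(i < m) (vol x r / (m%:R *+ 2))%:E)%E by [].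
    elim/big_rec2: _ => [|i s B _ [mB' muB]]; first by rewrite measure0.
    have [mE muE _] := HE i; split; first exact: measurableU.
    by apply: (le_trans (measureU2 _ _ _)) => //; exact: leeD.
  rewrite sumEFin lee_fin sumr_const card_ord -mulr_natr -[_ *+ 2]mulr_natr.
  by rewrite le_eqVlt; apply/orP; left; apply/eqP; field; rewrite pnatr_eq0 -lt0n.
(* [Z] is null and [U] fills at most half of the ball, so some point of the ball avoids both. *)
have [y [By Zy Uy]] : exists y, [/\ euclid_ball x r y, ~ Z y & ~ U y].
  apply: contrapT => /forallNP H.
  have BZU : (mu (euclid_ball x r) <= mu (Z `|` U))%E.
    apply: le_measure; rewrite ?inE//; first exact: measurableU.
    move=> y By; apply: contrapT => /not_orP[Zy Uy]; exact: (H y).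
  have := le_trans BZU (measureU2 mu mZ mU).
  rewrite [X in (_ <= X + _)%E]Z0 add0e => /le_trans-/(_ _ muU).
  by rewrite measure_euclid_ball// lee_fin; lra.
have {}Uy i : ~ E i y.
  by apply: contra_not Uy => Ey; rewrite /U (bigD1 i)//=; left.
have Wy : \prod_(i < m) v i y <= fine W.
  rewrite -lee_fin fineK//; apply: contrapT => NW; apply: Zy; apply: WZ => /=.
  rewrite indicE mem_set// mul1r ger0_norm ?prodr_ge0//.
  by move=> i _; exact: ltW.
rewrite -(fineK Wfin) /P (eq_bigr (fun i => (a i)%:E)) => [|i _]; last exact: aE.
rewrite prodEFin -EFinM lee_fin.
have mm0 : 0 < (m%:R *+ 2) ^+ m :> R by rewrite exprn_gt0.
rewrite -div1r ler_pdivrMr//.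
have pv0 : 0 < \prod_(i < m) v i y by exact: prodr_gt0.
(* At the chosen point, 1 is the product of all [v i y] and their inverses; the former is at most
   [W], and each inverse is at most [2 m a_i]. *)
have {1}<- : \prod_(i < m) v i y * \prod_(i < m) (v i y)^-1 = 1.
  by rewrite prodfV mulfV// gt_eqF.
have -> : fine W * \prod_(i < m) a i * (m%:R *+ 2) ^+ m =
    fine W * \prod_(i < m) (m%:R *+ 2 * a i).
  by rewrite big_split/= prodr_const card_ord mulrAC -mulrA.
apply: ler_pM => //; first exact: ltW.
  by apply: prodr_ge0 => i _; rewrite invr_ge0 ltW.
apply: ler_prod => i _; rewrite invr_ge0 (ltW (v0 _ _))/=.
by have [_ _] := HE i; apply.
Qed.

End lower_bound.

(** * Products of powers and of suprema; conjugate exponents *)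

Lemma powR_sum {R : realType} (I : finType) (r : R) (f : I -> R) : 0 < r ->
  \prod_i r `^ f i = r `^ (\sum_i f i).
Proof.
move=> r0; rewrite (big_morph (fun a => r `^ a) (op1 := *%R) (id1 := 1))//.
  by move=> a b; rewrite powRD//; apply/implyP => _; rewrite gt_eqF.
by rewrite powRr0.
Qed.

(** Each supremum is within a factor 2 of an attained value, and the indices may be chosen
    independently. A joint bound on the product thus splits into one bound [S i] per sequence, as
    needed to apply [H_factor_le] to each weight separately. *)
Lemma prod_near_sup {R : realType} (I : finType) (f : I -> nat -> R) (M : R) :
  (forall i k, 0 < f i k) -> (forall k : I -> nat, \prod_i f i (k i) <= M) ->
  exists S : I -> R, (forall i k, f i k <= S i) /\ \prod_i S i <= 2 ^+ #|I| * M.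
Proof.
move=> f0 fM.
have has_sup_f i : has_sup (range (f i)).
  split; first by exists (f i 0), 0.
  (* Freezing the other indices at 0 leaves a positive constant and so bounds the i-th sequence. *)
  exists (M / \prod_(j | j != i) f j 0) => _ [k _ <-].
  rewrite ler_pdivlMr ?prodr_gt0//.
  have := fM (fun j => if j == i then k else 0).
  rewrite (bigD1 i)//= eqxx; congr (_ * _ <= _).
  by apply: eq_bigr => j /negbTE ->.
have f_sup i k : f i k <= sup (range (f i)).
  by apply: ub_le_sup; [have [] := has_sup_f i|exists k].
have S0 i : 0 < sup (range (f i)) by exact: lt_le_trans (f0 i 0) _.
exists (fun i => sup (range (f i))); split => //.
have /choice[k Hk] : forall i, exists k, sup (range (f i)) <= 2 * f i k.
  move=> i; have e0 : 0 < sup (range (f i)) / 2 by rewrite divr_gt0.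
  by have [_ [k _ <-] ?] := sup_adherent e0 (has_sup_f i); exists k; lra.
apply: (@le_trans _ _ (\prod_i (2 * f i (k i)))).
  by apply: ler_prod => i _; rewrite Hk ltW.
by rewrite big_split/= prodr_const ler_wpM2l// exprn_ge0.
Qed.

Lemma inv_exponent_hoelder_conjugate {R : realType} (p : \bar R) : (1 <= p)%E ->
  fine p^-1%E = 1 - inv_exponent (hoelder_conjugate p).
Proof.
move=> p1; have q1 := hoelder_conj_ge1 p1.
have inv_fin (a : \bar R) : (1 <= a)%E -> (a^-1)%E \is a fin_num.
  case: a => [a|_|]//.
  by rewrite lee_fin => a1; rewrite inver gt_eqF//; lra.
have p0 : (0 < p)%E by rewrite (lt_le_trans _ p1)// lte01.
have := hoelder_conjugate_eq1 (lt_trans (ltNyr 0) p0) (negbT (gt_eqF p0)).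
move=> /(congr1 fine); rewrite fineD ?inv_fin// /inv_exponent /= => <-.
by rewrite addrK.
Qed.

(** * Comparison of the products in A and H_m *)

Section multilinear.
Context {R : realType} {m n : nat}.
Hypotheses (m_gt0 : (0 < m)%N) (n_gt0 : (0 < n)%N).
Implicit Types (x : Rn R n) (r t : R).
Variables (v : 'I_m -> Rn R n -> R) (q : 'I_m -> \bar R).
Hypotheses (v_weight : forall i, weight (v i)) (q_ge1 : forall i, (1 <= q i)%E).

Definition product_norm x r : \bar R :=
  Linfty_norm (fun y => \1_(euclid_ball x r) y * \prod_(i < m) v i y).

Lemma product_norm_ge0 x r : (0 <= product_norm x r)%E.
Proof. exact: Lnorm_ge0. Qed.

Lemma product_norm_le x r r' : r <= r' -> (product_norm x r <= product_norm x r')%E.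
Proof.
move=> rr'; apply/Linfty_normP => //.
have /Linfty_normP-/(_ n_gt0) := lexx (product_norm x r').
apply: filterS => y; apply: le_trans; rewrite lee_fin !normrM ler_wpM2r//.
rewrite !indicE; have [/set_mem yB|_] := boolP (y \in euclid_ball x r).
  by rewrite mem_set//; exact: euclid_ballS yB.
by rewrite normr0.
Qed.

(** The normalisation of the average contributes a multiple of [r^(-n/q)], and the size of the
    kernel on the ball contributes [r^t]. *)
Lemma A_factor_le_H_factor t (i : 'I_m) : exists2 K : R, 0 < K &
  forall x r, 0 < r -> (A_factor (v i) (q i) x r <=
    (K * r `^ (t - n%:R * inv_exponent (q i)))%:E * H_factor (v i) (q i) t x r)%E.
Proof.
have [K K0 HK] := ball_norm_le_H_factor n_gt0 t.
set a := inv_exponent _.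
have [L L0 HL] := @vol_powR_le R n n_gt0 (- (n%:R * a)).
exists (L * K); first by rewrite mulr_gt0.
move=> x r r0; rewrite A_factorE// -/a.
have n0 : n%:R != 0 :> R by rewrite pnatr_eq0 -lt0n.
have := HL x r r0; rewrite mulNr mulrAC divff// mul1r => Hv.
apply: (@le_trans _ _ ((L * r `^ (- (n%:R * a)))%:E *
    ((K * r `^ t)%:E * H_factor (v i) (q i) t x r))%E).
  by rewrite lee_pmul ?lee_fin ?powR_ge0 ?ball_norm_ge0// HK.
rewrite muleA -EFinM addrC powRD; first by rewrite mulrACA.
by apply/implyP => _; rewrite gt_eqF.
Qed.

Lemma inv_exponent_ge0 i : 0 <= inv_exponent (q i).
Proof.
rewrite /inv_exponent; have := q_ge1 i; case: (q i) => [s|_|]//.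
by rewrite lee_fin fine_invr invr_ge0; lra.
Qed.

(** The [m] comparisons of factors multiply to the exponent [m t - n sum 1/q_i]; clearing the
    divisor [|B|^(e/n)] adds [e]. *)
Lemma product_A_factor_le t e (C : R) : 0 < C ->
  (forall x r, 0 < r -> (product_norm x r / (vol x r `^ (e / n%:R))%:E *
    \prod_(i < m) H_factor (v i) (q i) t x r <= C%:E)%E) ->
  exists2 K : R, 0 < K & forall x r, 0 < r ->
    (product_norm x r * \prod_(i < m) A_factor (v i) (q i) x r <=
     (K * r `^ (m%:R * t - n%:R * (\sum_(i < m) inv_exponent (q i)) + e))%:E)%E.
Proof.
move=> C0 HC.
have /choice[K HK] : forall i, exists K : R, 0 < K /\
  forall x r, 0 < r -> (A_factor (v i) (q i) x r <=
    (K * r `^ (t - n%:R * inv_exponent (q i)))%:E * H_factor (v i) (q i) t x r)%E.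
  by move=> i; have [K] := A_factor_le_H_factor t i; exists K.
have [L L0 HL] := @vol_powR_le R n n_gt0 e.
have K0 i : 0 < K i by have [] := HK i.
have PK0 : 0 < \prod_(i < m) K i by exact: prodr_gt0.
exists (\prod_(i < m) K i * L * C); first by rewrite !mulr_gt0.
move=> x r r0; have V0 := vol_gt0 n_gt0 x r r0.
set X := vol x r `^ (e / n%:R); have X0 : 0 < X by rewrite powR_gt0.
set c := \prod_(i < m) K i * r `^ (m%:R * t - n%:R * (\sum_(i < m) inv_exponent (q i))).
have c0 : 0 <= c by rewrite mulr_ge0 ?powR_ge0 ?ltW.
set H := (\prod_(i < m) H_factor (v i) (q i) t x r)%E.
have AH : (\prod_(i < m) A_factor (v i) (q i) x r <= c%:E * H)%E.
  apply: (@le_trans _ _ (\prod_(i < m)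
    ((K i * r `^ (t - n%:R * inv_exponent (q i)))%:E * H_factor (v i) (q i) t x r))%E).
    by apply: prode_le => i; [exact: A_factor_ge0|have [_] := HK i; exact].
  rewrite big_split/= prodEFin big_split/= powR_sum// sumrB sumr_const card_ord.
  by rewrite -mulr_sumr -[t *+ m]mulr_natl.
apply: (@le_trans _ _ (product_norm x r * (c%:E * H))%E).
  by rewrite lee_wpmul2l// product_norm_ge0.
apply: (@le_trans _ _ ((c * X)%:E * C%:E)%E).
  have := HC x r r0; rewrite -/X -/H inver gt_eqF//.
  move=> /(@lee_wpmul2l _ (c * X)%:E); rewrite lee_fin mulr_ge0 ?(ltW X0)// => /(_ isT).
  apply: le_trans; rewrite le_eqVlt; apply/orP; left; apply/eqP.
  rewrite (EFinM c X) -!muleA [LHS]muleCA; congr (_ * _)%E.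
  rewrite [RHS]muleCA; congr (_ * _)%E.
  by rewrite [RHS]muleA -EFinM divff ?gt_eqF// mul1e.
rewrite -EFinM lee_fin powRD; last by apply/implyP => _; rewrite gt_eqF.
have -> : forall a b c d f : R, a * b * c * (d * f) = (a * d) * (b * f) * c.
  by move=> *; ring.
rewrite ler_wpM2r ?(ltW C0)// ler_wpM2l// HL//.
Qed.

(** The A-bound controls only products of norms over a common ball. Balls of different dyadic sizes
    are enlarged to the largest, and [prod_near_sup] then yields a separate growth bound for each
    weight. *)
Lemma product_H_factor_le t (M : R) :
  n%:R * (\sum_(i < m) inv_exponent (q i)) < t -> 0 < M ->
  (forall x r, 0 < r ->
    (product_norm x r * \prod_(i < m) A_factor (v i) (q i) x r <= M%:E)%E) ->
  exists2 K : R, 0 < K & forall x r, 0 < r ->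
    (product_norm x r * \prod_(i < m) H_factor (v i) (q i) t x r <=
     (K * r `^ (n%:R * (\sum_(i < m) inv_exponent (q i)) - m%:R * t))%:E)%E.
Proof.
set s := _ * _ => st M0 HM.
have sum0 : 0 <= \sum_(i < m) inv_exponent (q i).
  by apply: sumr_ge0 => i _; exact: inv_exponent_ge0.
have s0 : 0 <= s by rewrite mulr_ge0.
pose e := (s + t) / 2; have et : e < t by rewrite /e; lra.
have se : s <= e by rewrite /e; lra.
have t0 : 0 <= t by lra.
have /choice[K HK] : forall i, exists K : R, 0 < K /\
    forall v x r S, weight v -> 0 < r -> 0 <= S ->
    (forall k, (ball_norm v (q i) x (2 ^+ k * r) <= ((2 ^+ k) `^ e * S)%:E)%E) ->
    (H_factor v (q i) t x r <= (K * r `^ (- t) * S)%:E)%E.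
  by move=> i; have [K] := H_factor_le n_gt0 _ _ _ et t0 (q_ge1 i); exists K.
have [L L0 HL] := @vol_powR_le R n n_gt0 s.
have K0 i : 0 < K i by have [] := HK i.
have PK0 : 0 < \prod_(i < m) K i by exact: prodr_gt0.
exists (\prod_(i < m) K i * (2 ^+ m * (L * M))).
  by rewrite !mulr_gt0// exprn_gt0.
move=> x r r0.
have r2 k : 0 < 2 ^+ k * r by rewrite mulr_gt0// exprn_gt0.
have n0 : n%:R != 0 :> R by rewrite pnatr_eq0 -lt0n.
have AN r' (r'0 : 0 < r') i : ball_norm (v i) (q i) x r' =
    ((vol x r' `^ inv_exponent (q i))%:E * A_factor (v i) (q i) x r')%E.
  rewrite A_factorE// muleA -EFinM -powRD ?subrr ?powRr0 ?mul1e//.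
  by apply/implyP => _; rewrite gt_eqF// vol_gt0.
(* The universal lower bound excludes a zero essential supremum. With every factor positive,
   finiteness of the product then gives finiteness of each factor. *)
have W_gt0 r' : 0 < r' -> (0 < product_norm x r')%E.
  move=> r'0; rewrite lt0e product_norm_ge0 andbT; apply/negP => /eqP W0.
  have := A_pinfty_product_ge n_gt0 m v q x r' m_gt0 v_weight q_ge1 r'0.
  rewrite -/(product_norm x r') W0 mul0e lee_fin leNgt invr_gt0 exprn_gt0//.
  by rewrite mulrn_wgt0// ltr0n.
have A_gt0 r' : 0 < r' -> (0 < \prod_(i < m) A_factor (v i) (q i) x r')%E.
  by move=> r'0; apply: prode_gt0 => i; exact: A_factor_gt0.
have HM' r' : 0 < r' -> (product_norm x r' * \prod_(i < m) A_factor (v i) (q i) x r' < +oo)%E.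
  by move=> r'0; rewrite (le_lt_trans (HM _ _ _)) ?ltry.
have W_fin : product_norm x r \is a fin_num.
  rewrite ge0_fin_numE ?product_norm_ge0//.
  by apply: mule_lty_gt0 (HM' r r0); [exact: W_gt0|exact: A_gt0].
have A_fin r' i : 0 < r' -> A_factor (v i) (q i) x r' \is a fin_num.
  move=> r'0; rewrite ge0_fin_numE ?A_factor_ge0//; move: i.
  apply: prode_lty_gt0 => [i|]; first exact: A_factor_gt0.
  by apply: mule_lty_gt0 (A_gt0 _ r'0) (W_gt0 _ r'0) _; rewrite muleC HM'.
have N_fin r' i : 0 < r' -> ball_norm (v i) (q i) x r' \is a fin_num.
  by move=> r'0; rewrite AN// fin_numM// A_fin.
pose w := fine (product_norm x r).
have wE : product_norm x r = w%:E by rewrite fineK.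
have w0 : 0 < w by rewrite -lte_fin -wE W_gt0.
(* Normalised so that [f i k <= S i] is exactly the growth hypothesis of [H_factor_le]. *)
pose f i k := (2 ^+ k) `^ (- e) * fine (ball_norm (v i) (q i) x (2 ^+ k * r)).
have f0 i k : 0 < f i k.
  rewrite mulr_gt0 ?powR_gt0 ?exprn_gt0//.
  by rewrite -lte_fin fineK ?N_fin// ball_norm_gt0.
have fM (k : 'I_m -> nat) : \prod_i f i (k i) <= L * M * r `^ s / w.
  pose k1 := \max_i k i.
  have kk1 i : (k i <= k1)%N by exact: leq_bigmax.
  (* As [e >= 0], the powers [(2^(k i))^(-e)] multiply to [2^(- e sum k_i)], which is at most
     [2^(- e k1)]. *)
  have k1_sum : (k1 <= \sum_i k i)%N.
    by apply/bigmax_leqP => i _; rewrite (bigD1 i)//= leq_addr.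
  have P2 : \prod_(i < m) (2 ^+ k i : R) `^ (- e) <= (2 ^+ k1) `^ (- e).
    rewrite (eq_bigr (fun i => 2 `^ (k i)%:R `^ (- e))); last first.
      by move=> i _; rewrite powR_mulrn.
    rewrite -[(2 ^+ k1 : R)]powR_mulrn//.
    rewrite (eq_bigr (fun i => (2 : R) `^ ((k i)%:R * - e))); last first.
      by move=> i _; rewrite powRrM.
    rewrite powR_sum// -powRrM ler_powR ?ler1n//.
    rewrite -mulr_suml -natr_sum !mulrN lerN2 ler_wpM2r ?ler_nat//.
    exact: le_trans se.
  (* Radius of the largest ball, to which all the norms and [W] are enlarged before the A-bound is
     used. *)
  pose r1 := 2 ^+ k1 * r; have r10 : 0 < r1 by exact: r2.
  have PN : (w%:E * \prod_(i < m) ball_norm (v i) (q i) x (2 ^+ k i * r) <=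
      (L * r1 `^ s * M)%:E)%E.
    apply: (@le_trans _ _ (product_norm x r1 * \prod_(i < m) ball_norm (v i) (q i) x r1)%E).
      apply: lee_pmul; rewrite ?lee_fin ?(ltW w0)//.
      - by apply: prode_ge0 => i _; exact: ball_norm_ge0.
      - by rewrite -wE; apply: product_norm_le; rewrite ler_peMl ?(ltW r0)// exprn_ege1// ler1n.
      apply: prode_le => i; first exact: ball_norm_ge0.
      apply: ball_norm_le => //; rewrite ler_wpM2r ?(ltW r0)//.
      by rewrite ler_weXn2l ?ler1n.
    rewrite (eq_bigr _ (fun i _ => AN r1 r10 i)) big_split/= prodEFin muleCA.
    rewrite powR_sum ?vol_gt0// EFinM lee_pmul ?lee_fin ?powR_ge0//.
    - by rewrite mule_ge0 ?product_norm_ge0 ?ltW// A_gt0.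
    - by have := HL x r1 r10; rewrite /s mulrAC divff// mul1r.
    - exact: HM.
  rewrite big_split/= ler_pdivlMr//.
  have {}PN : \prod_(i < m) fine (ball_norm (v i) (q i) x (2 ^+ k i * r)) * w <=
      L * r1 `^ s * M.
    rewrite -lee_fin; apply: le_trans PN; rewrite EFinM -prodEFin muleC.
    by rewrite (eq_bigr _ (fun i _ => fineK (N_fin _ i (r2 (k i))))).
  rewrite -[leLHS]mulrA; apply: (@le_trans _ _ ((2 ^+ k1) `^ (- e) * (L * r1 `^ s * M))).
    apply: ler_pM => //; first by apply: prodr_ge0 => i _; exact: powR_ge0.
    by rewrite mulr_ge0 ?(ltW w0)//; apply: prodr_ge0 => i _; rewrite fine_ge0 ?ball_norm_ge0.
  rewrite /r1 powRM ?(ltW r0) ?exprn_ge0//.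
  have -> : (2 ^+ k1) `^ (- e) * (L * ((2 ^+ k1) `^ s * r `^ s) * M) =
     ((2 ^+ k1) `^ (- e) * (2 ^+ k1) `^ s) * (L * M * r `^ s) by ring.
  (* What remains is [(2^k1)^(s - e) <= 1], a consequence of [s <= e]. *)
  rewrite ler_piMl ?mulr_ge0 ?powR_ge0 ?(ltW L0) ?(ltW M0)//.
  rewrite -powRD; last by apply/implyP => _; rewrite gt_eqF// exprn_gt0.
  rewrite -[leRHS](powRr0 (2 ^+ k1)) ler_powR//; last by rewrite addrC subr_le0.
  by rewrite exprn_ege1// ler1n.
have [S [fS PS]] := prod_near_sup _ f _ f0 fM.
have S0 i : 0 <= S i by rewrite (le_trans _ (fS i 0)) ?ltW.
have HS i : (H_factor (v i) (q i) t x r <= (K i * r `^ (- t) * S i)%:E)%E.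
  have [_] := HK i; apply => // k.
  rewrite -(fineK (N_fin _ i (r2 k))) lee_fin.
  apply: le_trans (ler_wpM2l (powR_ge0 _ _) (fS i k)).
  rewrite /f mulrA -powRD ?subrr ?powRr0 ?mul1r//.
  by apply/implyP => _; rewrite gt_eqF// exprn_gt0.
have H_ge0 i : (0 <= H_factor (v i) (q i) t x r)%E.
  by have := q_ge1 i; case: (q i) => [a||]// _; [exact: poweR_ge0|exact: Lnorm_ge0].
rewrite wE; apply: (@le_trans _ _ (w%:E * \prod_(i < m) (K i * r `^ (- t) * S i)%:E)%E).
  by rewrite lee_wpmul2l ?lee_fin ?(ltW w0)//; exact: prode_le.
rewrite prodEFin -EFinM lee_fin !big_split/= powR_sum// sumr_const card_ord.
rewrite [leLHS]mulrCA -[leLHS]mulrA; apply: (@le_trans _ _ (\prod_(i < m) K i *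
    (r `^ (- t *+ m) * (w * (2 ^+ m * (L * M * r `^ s / w)))))).
  rewrite ler_wpM2l ?(ltW PK0)// ler_wpM2l ?powR_ge0// ler_wpM2l ?(ltW w0)//.
  by move: PS; rewrite card_ord.
rewrite le_eqVlt; apply/orP; left; apply/eqP.
have -> : r `^ (s - m%:R * t) = r `^ s * r `^ (- t *+ m).
  rewrite -powRD; last by apply/implyP => _; rewrite gt_eqF.
  by congr (_ `^ (_ + _)); rewrite -[RHS]mulr_natl mulrN.
by field; rewrite gt_eqF.
Qed.

End multilinear.

(** * The two implications *)

Theorem corollary6p4 (R : realType) (m n : nat) (m_gt0 : (0 < m)%N)
    (n_gt0 : (0 < n)%N) (d beta dt : R)
    (beta_gt0 : 0 < beta) (beta_lt : beta < m%:R * n%:R)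
    (dt_lt : dt < (beta - m%:R * n%:R) * (1 - m%:R^-1) + d / m%:R)
    (p : 'I_m -> \bar R) (p_ge1 : forall i, (1 <= p i)%E)
    (v : 'I_m -> Rn R n -> R) (v_weight : forall i, weight (v i)) :
  (Hm v p beta d dt -> A_pinfty v p) /\
  (dt = beta - n%:R * inv_p p -> A_pinfty v p -> Hm v p beta d dt).
Proof.
pose q i := hoelder_conjugate (p i).
have q_ge1 i : (1 <= q i)%E by exact: hoelder_conj_ge1.
pose t : R := n%:R - beta / m%:R + d / m%:R.
(* The factor [n] is left out of [s] here, so that [1/p = m - s]. *)
pose s := \sum_(i < m) inv_exponent (q i).
have invpE : inv_p p = m%:R - s.
  rewrite /inv_p (eq_bigr (fun i => 1 - inv_exponent (q i))); last first.
    by move=> i _; exact: inv_exponent_hoelder_conjugate.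
  by rewrite sumrB sumr_const card_ord.
have mR0 : m%:R != 0 :> R by rewrite pnatr_eq0 -lt0n.
have mt : m%:R * t = m%:R * n%:R - beta + d by rewrite /t; field.
have normE x r : Linfty_norm (fun y => (\prod_(i < m) v i y) * \1_(euclid_ball x r) y) =
    product_norm v x r.
  by congr Linfty_norm; apply/funext => y; rewrite mulrC.
split=> [[C C0 HC]|dtE AP].
- have HC' x r : 0 < r -> (product_norm v x r / (vol x r `^ ((dt - d) / n%:R))%:E *
      \prod_(i < m) H_factor (v i) (q i) t x r <= C%:E)%E.
    by move=> /(HC x r); rewrite normE.
  have [K K0 HK] := product_A_factor_le n_gt0 v q v_weight q_ge1 t (dt - d) C C0 HC'.
  move: HK; rewrite -/s; set g := _ + (dt - d) => HK.
  (* Expanding [t] and [s] shows that [g] is [dt - (beta - n/p)]. *)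
  have g0 : g = 0.
    apply: contrapT => /eqP gn0.
    pose c : R := ((m%:R *+ 2) ^+ m)^-1.
    have c0 : 0 < c by rewrite invr_gt0 exprn_gt0// mulrn_wgt0// ltr0n.
    pose r := (c / (2 * K)) `^ g^-1.
    have cK0 : 0 < c / (2 * K) by rewrite divr_gt0// mulr_gt0.
    have r0 : 0 < r by exact: powR_gt0.
    pose o : Rn R n := [tuple 0 | i < n].
    have := A_pinfty_product_ge n_gt0 m v q o r m_gt0 v_weight q_ge1 r0.
    move=> /le_trans/(_ (HK o r r0)); rewrite lee_fin /r -powRrM mulVf//.
    rewrite powRr1 ?(ltW cK0)// -/c.
    have -> : K * (c / (2 * K)) = c / 2 by field; rewrite gt_eqF.
    by lra.
  apply: (@le_lt_trans _ _ K%:E); last exact: ltry.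
  apply: ge_ereal_sup => _ [x [r [r0 ->]]].
  by have := HK x r r0; rewrite g0 powRr0 mulr1.
have st : n%:R * s < t.
  move: dt_lt; rewrite dtE invpE.
  (* Both sides contain [beta - m n]: [dt] adds [n s] to it and the upper bound on [dt] adds [t]. *)
  have -> : (beta - m%:R * n%:R) * (1 - m%:R^-1) + d / m%:R = beta - m%:R * n%:R + t.
    by rewrite /t; field.
  by lra.
have [M M0 HM] : exists2 M : R, 0 < M & forall x r, 0 < r ->
    (product_norm v x r * \prod_(i < m) A_factor (v i) (q i) x r <= M%:E)%E.
  move: AP; rewrite /A_pinfty; set E := [set _ | _] => supE.
  have [B B0 supB] : exists2 B : R, 0 < B & (ereal_sup E <= B%:E)%E.
    case: (ereal_sup E) supE => [a|//|] _; last by exists 1; rewrite ?leNye.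
    by exists (Num.max a 1); rewrite ?lee_fin ?lt_max ?ltr01 ?orbT// le_max lexx.
  exists B => // x r r0; apply: le_trans supB; apply: ereal_sup_ubound.
  by exists x, r.
have [K K0 HK] := product_H_factor_le m_gt0 n_gt0 v q v_weight q_ge1 t M st M0 HM.
have [L L0 HL] := @vol_powR_le R n n_gt0 (d - dt).
exists (L * K); first exact: mulr_gt0.
move=> x r r0; rewrite normE.
have V0 := vol_gt0 n_gt0 x r r0.
rewrite inver gt_eqF ?powR_gt0// -powRN -mulNr opprB muleAC muleC.
apply: (@le_trans _ _ ((L * r `^ (d - dt))%:E * (K * r `^ (n%:R * s - m%:R * t))%:E)%E).
  apply: lee_pmul; rewrite ?lee_fin ?powR_ge0 ?HL//; last exact: HK.
  rewrite mule_ge0 ?product_norm_ge0//; apply: prode_ge0 => i _.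
  by have := q_ge1 i; rewrite /q; case: hoelder_conjugate => [a||]// _;
    [exact: poweR_ge0|exact: Lnorm_ge0].
rewrite -EFinM lee_fin mulrACA -powRD; last by apply/implyP => _; rewrite gt_eqF.
(* All powers of [r] cancel, by the homogeneity relation [dt = beta - n/p]. *)
have -> : d - dt + (n%:R * s - m%:R * t) = 0 by rewrite mt dtE invpE; ring.
by rewrite powRr0 mulr1.
Qed.
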